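(* Let $A\;_Q\otimes_R B$ be an L-R-twisted tensor product of algebras such that $Q:A\otimes B\to A\otimes B$ is bijective with inverse $Q^{-1}$. Then the map $P:B\otimes A\rightarrow A\otimes B$, $P=Q^{-1}\circ R$, is a twisting map, and $Q$ is an algebra isomorphism $Q:A\otimes_P B\rightarrow A\;_Q\otimes_R B$. (Thus an L-R-twisted tensor product with bijective $Q$ is isomorphic to an ordinary twisted tensor product.)
   Context: All algebras, linear maps and tensor products are over a field $k$; algebras are associative and unital. Let $A$, $B$ be algebras. Notation: for linear maps $R:B\otimes A\to A\otimes B$ and $Q:A\otimes B\to A\otimes B$ write $R(b\otimes a)=a_R\otimes b_R$, $Q(a\otimes b)=a_Q\otimes b_Q$ (implicit summation); $r$, $q$ denote further independent copies of $R$, $Q$; nested subscripts mean successive application, the subscript closest to the letter being applied first ($a_{R_Q}=(a_R)_Q$). Twisting map: a linear map $R:B\otimes A\to A\otimes B$ is a twisting map between $A$ and $B$ if, for all $a,a'\in A$, $b,b'\in B$: (1) $a_R\otimes 1_R=a\otimes 1$, $1_R\otimes b_R=1\otimes b$; (2) $(aa')_R\otimes b_R=a_Ra'_r\otimes b_{R_r}$; (3) $a_R\otimes (bb')_R=a_{R_r}\otimes b_rb'_R$. Then $A\otimes B$ with multiplication $(a\otimes b)(a'\otimes b')=aa'_R\otimes b_Rb'$ is an associative algebra with unit $1\otimes 1$, denoted $A\otimes_R B$ (twisted tensor product). L-R-twisted tensor product: saying that $A\;_Q\otimes_R B$ is an L-R-twisted tensor product of algebras means that $R:B\otimes A\to A\otimes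 B$ and $Q:A\otimes B\to A\otimes B$ are linear maps such that $R$ satisfies (1)–(3) and, for all $a,a'\in A$, $b,b'\in B$: (4) $a_Q\otimes 1_Q=a\otimes 1$, $1_Q\otimes b_Q=1\otimes b$; (5) $(aa')_Q\otimes b_Q=a_qa'_Q\otimes b_{Q_q}$; (6) $a_Q\otimes (bb')_Q=a_{Q_q}\otimes b_Qb'_q$; (7) $b_R\otimes a_{R_Q}\otimes b'_Q=b_R\otimes a_{Q_R}\otimes b'_Q$; (8) $a_R\otimes b_{R_Q}\otimes a'_Q=a_R\otimes b_{Q_R}\otimes a'_Q$. Then $A\;_Q\otimes_R B$ denotes $A\otimes B$ with the associative multiplication $(a\otimes b)(a'\otimes b')=a_Qa'_R\otimes b_Rb'_Q$ (where $a_Q\otimes b'_Q=Q(a\otimes b')$, $a'_R\otimes b_R=R(b\otimes a')$) and unit $1\otimes 1$. *)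

(* Defs.v *)
From HB Require Import structures.
From mathcomp Require Import all_boot all_algebra finmap.
From mathcomp Require Import boolp.
From mathcomp Require Import monalg.

Set Implicit Arguments.
Unset Strict Implicit.
Unset Printing Implicit Defensive.

Import GRing.Theory.
Local Open Scope ring_scope.
Local Open Scope quotient_scope.

(* Associative unital algebras.  MathComp's [algType] requires [1 != 0];      *)
(* this structure also allows the zero algebra.                               *)
HB.mixin Record Lmodule_isUAlgebra (k : fieldType) A of GRing.Lmodule k A := {
  uone : A;
  umul : A -> A -> A;
  umulA : associative umul;
  umul1 : left_id uone umul;
  umulr1 : right_id uone umul;
  umulDl : left_distributive umul +%R;
  umulDr : right_distributive umul +%R;
  umulZl : forall (c : k) x y, umul (c *: x) y = c *: umul x y;
  umulZr : forall (c : k) x y, umul x (c *: y) = c *: umul x y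
}.

#[short(type="ualgType")]
HB.structure Definition UAlgebra (k : fieldType) :=
  { A of Lmodule_isUAlgebra k A & GRing.Lmodule k A }.

HB.instance Definition _ (k : fieldType) (A : ualgType k) :=
  GRing.Zmodule_isPzRing.Build (UAlgebra.sort A)
    (@umulA k A) (@umul1 k A) (@umulr1 k A) (@umulDl k A) (@umulDr k A).

Definition ualg_of_alg (k : fieldType) (A : algType k) : ualgType k :=
  HB.pack_for (ualgType k) (A : Type) (GRing.Lmodule.on A)
    (Lmodule_isUAlgebra.Build k A (@mulrA A) (@mul1r A) (@mulr1 A)
       (@mulrDl A) (@mulrDr A)
       (fun c x y => esym (scalerAl c x y)) (fun c x y => esym (scalerAr c x y))).

Section UAlgebraTheory.
Context {k : fieldType} {A : ualgType k}.
Implicit Types (c : k) (x y : A).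

Lemma ualg_scalerAl c x y : c *: (x * y) = (c *: x) * y.
Proof. by rewrite /GRing.mul /= umulZl. Qed.

Lemma ualg_scalerAr c x y : c *: (x * y) = x * (c *: y).
Proof. by rewrite /GRing.mul /= umulZr. Qed.
End UAlgebraTheory.

Section Tensor.
Context {k : fieldType} (U V : lmodType k).

(* [U ⊗ V] is the quotient of the free vector space on pairs [(u, v)] by the  *)
(* span of the bilinearity relations.                                         *)
Inductive tensor_rel0 : {malg k[(U * V)%type]} -> Prop :=
| TensorRel0 : tensor_rel0 0
| TensorRelD x y : tensor_rel0 x -> tensor_rel0 y -> tensor_rel0 (x + y)
| TensorRelZ c x : tensor_rel0 x -> tensor_rel0 (c *: x)
| TensorRelDl u u' v :
    tensor_rel0 (<< (u + u', v) >> - << (u, v) >> - << (u', v) >>)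
| TensorRelDr u v v' :
    tensor_rel0 (<< (u, v + v') >> - << (u, v) >> - << (u, v') >>)
| TensorRelZl c u v : tensor_rel0 (<< (c *: u, v) >> - c *: << (u, v) >>)
| TensorRelZr c u v : tensor_rel0 (<< (u, c *: v) >> - c *: << (u, v) >>).

Definition tensor_rel : rel {malg k[(U * V)%type]} :=
  fun x y => `[< tensor_rel0 (x - y) >].

Lemma tensor_rel_refl : reflexive tensor_rel.
Proof. by move=> x; apply/asboolP; rewrite subrr; constructor. Qed.

Lemma tensor_rel_sym : symmetric tensor_rel.
Proof.
suff H x y : tensor_rel x y -> tensor_rel y x.
  by move=> x y; apply/idP/idP; exact: H.
move/asboolP => H; apply/asboolP.
by have := TensorRelZ (-1) H; rewrite scaleN1r opprB.
Qed.

Lemma tensor_rel_trans : transitive tensor_rel.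
Proof.
move=> y x z /asboolP H1 /asboolP H2; apply/asboolP.
by have := TensorRelD H1 H2; rewrite addrA subrK.
Qed.

Canonical tensor_equiv :=
  EquivRel tensor_rel tensor_rel_refl tensor_rel_sym tensor_rel_trans.

Definition tensor : Type := {eq_quot tensor_equiv}.

HB.instance Definition _ := Choice.on tensor.
HB.instance Definition _ := EqQuotient.on tensor.

Lemma pi_tensorP x y : tensor_rel0 (x - y) -> \pi_tensor x = \pi_tensor y.
Proof. by move=> H; apply/eqmodP/asboolP. Qed.

Lemma repr_pi_tensor x : tensor_rel0 (repr (\pi_tensor x) - x).
Proof. by apply/asboolP/(eqmodP tensor_equiv); rewrite reprK. Qed.

Definition tensor_add (x y : tensor) : tensor := \pi_tensor (repr x + repr y).
Definition tensor_opp (x : tensor) : tensor := \pi_tensor (- repr x).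
Definition tensor_scale (c : k) (x : tensor) : tensor :=
  \pi_tensor (c *: repr x).

Let tensor_addE x y :
  tensor_add (\pi_tensor x) (\pi_tensor y) = \pi_tensor (x + y).
Proof.
apply: pi_tensorP; rewrite opprD addrACA.
by apply: TensorRelD; apply: repr_pi_tensor.
Qed.

Let tensor_scaleE c x : tensor_scale c (\pi_tensor x) = \pi_tensor (c *: x).
Proof.
by apply: pi_tensorP; rewrite -scalerBr; apply/TensorRelZ/repr_pi_tensor.
Qed.

Let tensor_oppE x : tensor_opp (\pi_tensor x) = \pi_tensor (- x).
Proof.
rewrite -scaleN1r -tensor_scaleE /tensor_opp /tensor_scale.
by rewrite scaleN1r.
Qed.

Fact tensor_addA : associative tensor_add.
Proof.
move=> x y z; elim/quotW: x => x; elim/quotW: y => y; elim/quotW: z => z.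
by rewrite (tensor_addE y z) (tensor_addE x y) !tensor_addE addrA.
Qed.

Fact tensor_addC : commutative tensor_add.
Proof.
move=> x y; elim/quotW: x => x; elim/quotW: y => y.
by rewrite (tensor_addE x y) tensor_addE addrC.
Qed.

Fact tensor_add0 : left_id (\pi_tensor 0) tensor_add.
Proof. by move=> x; elim/quotW: x => x; rewrite !tensor_addE add0r. Qed.

Fact tensor_addN : left_inverse (\pi_tensor 0) tensor_opp tensor_add.
Proof. by move=> x; elim/quotW: x => x; rewrite tensor_oppE tensor_addE addNr. Qed.

HB.instance Definition _ :=
  GRing.isZmodule.Build tensor tensor_addA tensor_addC tensor_add0 tensor_addN.

Fact tensor_scaleA c d x :
  tensor_scale c (tensor_scale d x) = tensor_scale (c * d) x.
Proof.
by elim/quotW: x => x; rewrite (tensor_scaleE d x) !tensor_scaleE scalerA.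
Qed.

Fact tensor_scale1 : left_id 1 tensor_scale.
Proof. by move=> x; elim/quotW: x => x; rewrite tensor_scaleE scale1r. Qed.

Fact tensor_scaleDr : right_distributive tensor_scale +%R.
Proof.
move=> c x y; elim/quotW: x => x; elim/quotW: y => y.
rewrite /GRing.add /= (tensor_addE x y) (tensor_scaleE c x) (tensor_scaleE c y).
by rewrite tensor_addE tensor_scaleE scalerDr.
Qed.

Fact tensor_scaleDl x : {morph tensor_scale^~ x : c d / c + d}.
Proof.
elim/quotW: x => x c d.
rewrite [in RHS]/GRing.add /= (tensor_scaleE c x) (tensor_scaleE d x).
by rewrite tensor_addE tensor_scaleE scalerDl.
Qed.

HB.instance Definition _ := GRing.Zmodule_isLmodule.Build k tensor
  tensor_scaleA tensor_scale1 tensor_scaleDr tensor_scaleDl.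

Lemma pi_tensorD x y : \pi_tensor (x + y) = \pi_tensor x + \pi_tensor y.
Proof. exact/esym/tensor_addE. Qed.

Lemma pi_tensorZ c x : \pi_tensor (c *: x) = c *: \pi_tensor x.
Proof. exact/esym/tensor_scaleE. Qed.

Lemma pi_tensor0 : \pi_tensor 0 = 0.
Proof. by []. Qed.

Definition malg_ext {W : lmodType k} (f : U -> V -> W)
    (x : {malg k[(U * V)%type]}) : W :=
  \sum_(p <- msupp x) x@_p *: f p.1 p.2.
End Tensor.

HB.lock Definition tens (k : fieldType) (U V : lmodType k) (u : U) (v : V) :
  tensor U V := \pi_(tensor U V) << (u, v) >>.
Arguments tens {k U V} & u v.

HB.lock Definition tsum (k : fieldType) (U V W : lmodType k) (t : tensor U V)
  (f : U -> V -> W) : W := malg_ext f (repr t).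
Arguments tsum {k U V W} & t f.

Section TensorTheory.
Context {k : fieldType} {U V : lmodType k}.
Local Notation tensor := (tensor U V).

Lemma tensE (u : U) (v : V) : tens u v = \pi_tensor << (u, v) >>.
Proof. by rewrite tens.unlock. Qed.

Lemma tsumE {W : lmodType k} (t : tensor) (f : U -> V -> W) :
  tsum t f = malg_ext f (repr t).
Proof. by rewrite tsum.unlock. Qed.

Lemma tensDl (u u' : U) (v : V) : tens (u + u') v = tens u v + tens u' v.
Proof.
rewrite !tensE -pi_tensorD; apply: pi_tensorP.
by rewrite opprD addrA; apply: TensorRelDl.
Qed.

Lemma tensDr (u : U) (v v' : V) : tens u (v + v') = tens u v + tens u v'.
Proof.
rewrite !tensE -pi_tensorD; apply: pi_tensorP.
by rewrite opprD addrA; apply: TensorRelDr.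
Qed.

Lemma tensZl c (u : U) (v : V) : tens (c *: u) v = c *: tens u v.
Proof. by rewrite !tensE -pi_tensorZ; apply: pi_tensorP; apply: TensorRelZl. Qed.

Lemma tensZr c (u : U) (v : V) : tens u (c *: v) = c *: tens u v.
Proof. by rewrite !tensE -pi_tensorZ; apply: pi_tensorP; apply: TensorRelZr. Qed.

Lemma tens_linl (v : V) : linear (fun u : U => tens u v).
Proof. by move=> c x y; rewrite tensDl tensZl. Qed.

Lemma tens_linr (u : U) : linear (fun v : V => tens u v).
Proof. by move=> c x y; rewrite tensDr tensZr. Qed.

Section Lift.
Context {W : lmodType k}.
Implicit Types (f : U -> V -> W).

Lemma malg_extEw f (d : {fset (U * V)%type}) x : (msupp x `<=` d)%fset ->
  malg_ext f x = \sum_(p <- d) x@_p *: f p.1 p.2.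
Proof.
move=> sxd; rewrite /malg_ext (big_fset_incl _ sxd) // => p _ px.
by rewrite mcoeff_outdom // scale0r.
Qed.

Lemma malg_ext_linear f : linear (malg_ext f).
Proof.
move=> c x y; pose d := (msupp x `|` msupp y `|` msupp (c *: x + y))%fset.
rewrite !(@malg_extEw f d) /d ?fsubsetUr //; last first.
- by rewrite -fsetUA fsubsetUl.
- by rewrite (fsubset_trans (fsubsetUr (msupp x) _)) ?fsubsetUl.
rewrite scaler_sumr -big_split /=; apply: eq_bigr => p _.
by rewrite mcoeffD mcoeffZ scalerDl scalerA.
Qed.

HB.instance Definition _ f :=
  GRing.isLinear.Build k {malg k[(U * V)%type]} W *:%R (malg_ext f)
    (malg_ext_linear f).

Lemma malg_extU f u v : malg_ext f << (u, v) >> = f u v.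
Proof.
by rewrite (malg_extEw f msuppU_le) big_seq_fset1 mcoeffUU scale1r.
Qed.

Lemma malg_ext_rel0 f x : (forall v, linear (f^~ v)) -> (forall u, linear (f u)) ->
  tensor_rel0 x -> malg_ext f x = 0.
Proof.
move=> fl fr.
have fDl u u' v : f (u + u') v = f u v + f u' v.
  by have := fl v 1 u u'; rewrite !scale1r.
have fDr u v v' : f u (v + v') = f u v + f u v'.
  by have := fr u 1 v v'; rewrite !scale1r.
have f0l v : f 0 v = 0 by apply: (addrI (f 0 v)); rewrite -fDl !addr0.
have f0r u : f u 0 = 0 by apply: (addrI (f u 0)); rewrite -fDr !addr0.
elim=> [|{}x y _ Hx _ Hy|c {}x _ Hx|u u' v|u v v'|c u v|c u v].
- exact: linear0.
- by rewrite linearD /= Hx Hy addr0.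
- by rewrite linearZ /= Hx scaler0.
- by rewrite !linearB /= !malg_extU fDl addrAC addrK subrr.
- by rewrite !linearB /= !malg_extU fDr addrAC addrK subrr.
- rewrite linearB linearZ /= !malg_extU; apply/eqP; rewrite subr_eq0; apply/eqP.
  by have := fl v c u 0; rewrite !addr0 f0l addr0.
- rewrite linearB linearZ /= !malg_extU; apply/eqP; rewrite subr_eq0; apply/eqP.
  by have := fr u c v 0; rewrite !addr0 f0r addr0.
Qed.

Lemma tsum_pi f x : (forall v, linear (f^~ v)) -> (forall u, linear (f u)) ->
  tsum (\pi_tensor x) f = malg_ext f x.
Proof.
move=> fl fr; apply/eqP; rewrite -subr_eq0 tsumE -linearB /=.
by rewrite (malg_ext_rel0 fl fr (repr_pi_tensor x)).
Qed.

Lemma tsum_tens f u v : (forall v, linear (f^~ v)) -> (forall u, linear (f u)) ->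
  tsum (tens u v) f = f u v.
Proof. by move=> fl fr; rewrite tensE tsum_pi // malg_extU. Qed.

Lemma tsum_linear f : (forall v, linear (f^~ v)) -> (forall u, linear (f u)) ->
  linear (tsum^~ f).
Proof.
move=> fl fr c; move=> x y; elim/quotW: x => x; elim/quotW: y => y.
by rewrite -pi_tensorZ -pi_tensorD !tsum_pi // linearP.
Qed.

End Lift.

Lemma tsum_id (t : tensor) : tsum t (fun u v => tens u v) = t.
Proof.
rewrite tsumE -[RHS]reprK [in RHS](monalgE (repr t)).
rewrite (big_morph _ (@pi_tensorD k U V) (@pi_tensor0 k U V)).
apply: eq_bigr => -[u v] _ /=.
rewrite !tensE -pi_tensorZ; congr (\pi_tensor _).
by apply/malgP => q; rewrite mcoeffZ !mcoeffU mulrnAr mulr1.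
Qed.

Section Linear.
Context {W W' : lmodType k}.

Lemma linear_tsum (g : W -> W') (f : U -> V -> W) t : linear g ->
  g (tsum t f) = tsum t (fun u v => g (f u v)).
Proof.
move=> gl.
pose G := HB.pack_for {linear W -> W'} g (GRing.isLinear.Build k _ _ *:%R g gl).
rewrite -[g]/(G : _ -> _) !tsumE /malg_ext linear_sum.
by apply: eq_bigr => p _; rewrite linearZ.
Qed.

Lemma eq_tsum (f g : U -> V -> W) t : f =2 g -> tsum t f = tsum t g.
Proof. by move=> fg; rewrite !tsumE; apply: eq_bigr => p _; rewrite fg. Qed.
End Linear.

Lemma tensor_ext {W : lmodType k} (f g : tensor -> W) : linear f -> linear g ->
  (forall u v, f (tens u v) = g (tens u v)) -> f =1 g.
Proof.
move=> fl gl fg t; rewrite -(tsum_id t) !linear_tsum //.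
exact: eq_tsum.
Qed.
End TensorTheory.

Reserved Notation "u ⊗ v" (at level 40, left associativity).
Reserved Notation "\tsum_ ( u ⊗ v <- t ) E"
  (at level 36, E at level 36, t at level 200, u name, v name,
   format "\tsum_ ( u  ⊗  v  <-  t )  E").

Notation "U ⊗ V" := (tensor U V) : type_scope.
Notation "u ⊗ v" := (tens u v) : ring_scope.

(* Sweedler notation: for [t = \sum_i u_i ⊗ v_i] this is [\sum_i E u_i v_i].  *)
(* [tsum] uses a chosen decomposition of [t]; when [E] is bilinear the result *)
(* does not depend on it, by [tsum_tens] and [tsum_linear].                   *)
Notation "\tsum_ ( u ⊗ v <- t ) E" := (tsum t (fun u v => E)) : ring_scope.

Section LinearityLemmas.
Context {k : fieldType}.
Implicit Types U V W X : lmodType k.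

Lemma lin_comp U V W (g : V -> W) (h : U -> V) :
  linear g -> linear h -> linear (fun x => g (h x)).
Proof. by move=> gl hl c x y; rewrite hl gl. Qed.

Lemma lin_id U : linear (fun x : U => x).
Proof. by []. Qed.

Lemma lin_tsum U V W X (F : X -> U -> V -> W) t :
  (forall u v, linear (fun x => F x u v)) ->
  linear (fun x => tsum t (F x)).
Proof.
move=> Fl c x y; rewrite !tsumE /malg_ext scaler_sumr -big_split /=.
by apply: eq_bigr => p _; rewrite Fl scalerDr !scalerA mulrC.
Qed.

Lemma tsum_exchange U V U' V' W (t : U ⊗ V) (s : U' ⊗ V')
    (F : U -> V -> U' -> V' -> W) :
  \tsum_(u ⊗ v <- t) \tsum_(u' ⊗ v' <- s) F u v u' v' =
  \tsum_(u' ⊗ v' <- s) \tsum_(u ⊗ v <- t) F u v u' v'.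
Proof.
rewrite tsum.unlock /malg_ext.
under eq_bigr do rewrite scaler_sumr.
under [RHS]eq_bigr do rewrite scaler_sumr.
rewrite exchange_big; apply: eq_bigr => p _; apply: eq_bigr => q _.
by rewrite !scalerA mulrC.
Qed.

Lemma lin_tens U V W (f : U -> V -> W) X (h : X -> tensor U V) : linear h ->
  (forall v, linear (f^~ v)) -> (forall u, linear (f u)) ->
  linear (fun x => tsum (h x) f).
Proof. by move=> hl fl fr; apply: (lin_comp (tsum_linear fl fr) hl). Qed.

Lemma lin_mull (A : ualgType k) (a : A) : linear (fun x : A => a * x).
Proof. by move=> c x y; rewrite mulrDr ualg_scalerAr. Qed.

Lemma lin_mulr (A : ualgType k) (a : A) : linear (fun x : A => x * a).
Proof. by move=> c x y; rewrite mulrDl ualg_scalerAl. Qed.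
End LinearityLemmas.

Ltac lin := cbv beta; match goal with
  | |- _ => solve [auto 3 with nocore]
  | |- forall _, _ => move=> ?; lin
  | |- GRing.linear_for _ (fun x => x) => exact: lin_id
  | |- GRing.linear_for _ (fun x => @tsum ?k ?U ?V ?W ?t (@?F x)) =>
      apply: (@lin_tsum k U V W _ F t); lin
  | |- GRing.linear_for _ (fun x => @tsum ?k ?U ?V ?W (@?h x) ?f) =>
      apply: (@lin_tens k U V W f _ h); lin
  | |- GRing.linear_for _ (fun x => @tens ?k ?U ?V (@?h x) ?v) =>
      apply: (@lin_comp k _ U _ (fun y => @tens k U V y v) h
        (@tens_linl k U V v)); lin
  | |- GRing.linear_for _ (fun x => @tens ?k ?U ?V ?u (@?h x)) =>
      apply: (@lin_comp k _ V _ (fun y => @tens k U V u y) h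
        (@tens_linr k U V u)); lin
  | |- GRing.linear_for _ (fun x => ?a * (@?h x)) =>
      apply: (@lin_comp _ _ _ _ _ h (lin_mull a)); lin
  | |- GRing.linear_for _ (fun x => (@?h x) * ?a) =>
      apply: (@lin_comp _ _ _ _ _ h (lin_mulr a)); lin
  | H : GRing.linear_for _ ?g |- GRing.linear_for _ (fun x => ?g (@?h x)) =>
      apply: (lin_comp H (h := h)); lin
  end.

Section Twisting.
Context {k : fieldType} {A B : ualgType k}.

(* In nested sums, the outer sum is the map applied first: for instance the   *)
(* right-hand side of [twist_Ml] is a_R a'_r ⊗ b_{R_r}.                       *)
Record twisting_map (R : B ⊗ A -> A ⊗ B) : Prop := TwistingMap {
  twist_linear : linear R;
  twist_1l : forall a, R (1 ⊗ a) = a ⊗ 1;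
  twist_1r : forall b, R (b ⊗ 1) = 1 ⊗ b;
  twist_Ml : forall a a' b, R (b ⊗ (a * a')) =
    \tsum_(a1 ⊗ b1 <- R (b ⊗ a)) \tsum_(a2 ⊗ b2 <- R (b1 ⊗ a'))
      ((a1 * a2) ⊗ b2);
  twist_Mr : forall a b b', R ((b * b') ⊗ a) =
    \tsum_(a1 ⊗ b1 <- R (b' ⊗ a)) \tsum_(a2 ⊗ b2 <- R (b ⊗ a1))
      (a2 ⊗ (b2 * b1))
}.

Record LR_twisting (R : B ⊗ A -> A ⊗ B) (Q : A ⊗ B -> A ⊗ B) : Prop :=
  LRTwisting {
  LR_twist : twisting_map R;
  LR_linear : linear Q;
  LR_1r : forall a, Q (a ⊗ 1) = a ⊗ 1;
  LR_1l : forall b, Q (1 ⊗ b) = 1 ⊗ b;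
  LR_Ml : forall a a' b, Q ((a * a') ⊗ b) =
    \tsum_(a1 ⊗ b1 <- Q (a' ⊗ b)) \tsum_(a2 ⊗ b2 <- Q (a ⊗ b1))
      ((a2 * a1) ⊗ b2);
  LR_Mr : forall a b b', Q (a ⊗ (b * b')) =
    \tsum_(a1 ⊗ b1 <- Q (a ⊗ b)) \tsum_(a2 ⊗ b2 <- Q (a1 ⊗ b'))
      (a2 ⊗ (b1 * b2));
  LR_RQl : forall a b b',
    \tsum_(a1 ⊗ b1 <- R (b ⊗ a)) \tsum_(a2 ⊗ b2 <- Q (a1 ⊗ b'))
      (b1 ⊗ (a2 ⊗ b2)) =
    \tsum_(a1 ⊗ b1 <- Q (a ⊗ b')) \tsum_(a2 ⊗ b2 <- R (b ⊗ a1))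
      (b2 ⊗ (a2 ⊗ b1));
  LR_RQr : forall a a' b,
    \tsum_(a1 ⊗ b1 <- R (b ⊗ a)) \tsum_(a2 ⊗ b2 <- Q (a' ⊗ b1))
      (a1 ⊗ (b2 ⊗ a2)) =
    \tsum_(a1 ⊗ b1 <- Q (a' ⊗ b)) \tsum_(a2 ⊗ b2 <- R (b1 ⊗ a))
      (a2 ⊗ (b2 ⊗ a1))
}.

Definition twist_mul (R : B ⊗ A -> A ⊗ B) (x y : A ⊗ B) : A ⊗ B :=
  \tsum_(a ⊗ b <- x) \tsum_(a' ⊗ b' <- y)
    \tsum_(a1' ⊗ b1 <- R (b ⊗ a')) ((a * a1') ⊗ (b1 * b')).

Definition LR_mul (R : B ⊗ A -> A ⊗ B) (Q : A ⊗ B -> A ⊗ B) (x y : A ⊗ B) :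
    A ⊗ B :=
  \tsum_(a ⊗ b <- x) \tsum_(a' ⊗ b' <- y)
    \tsum_(a1 ⊗ b1' <- Q (a ⊗ b')) \tsum_(a1' ⊗ b1 <- R (b ⊗ a'))
      ((a1 * a1') ⊗ (b1 * b1')).

Lemma id_LR_twisting R : twisting_map R -> LR_twisting R id.
Proof.
move=> hR; have Rl := twist_linear hR; split=> //.
- move=> a a' b; cbv beta; do 2 (rewrite tsum_tens; try by lin).
  by [].
- move=> a b b'; cbv beta; do 2 (rewrite tsum_tens; try by lin).
  by [].
- move=> a b b'; cbv beta; rewrite tsum_tens; try by lin.
  by apply: eq_tsum => a1 b1; rewrite tsum_tens //; lin.
- move=> a a' b; cbv beta; rewrite tsum_tens; try by lin.
  by apply: eq_tsum => a1 b1; rewrite tsum_tens //; lin.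
Qed.

Lemma tsum_tsum (U V U' V' W : lmodType k) (t : U ⊗ V)
    (F : U -> V -> U' ⊗ V') (G : U' -> V' -> W) :
  (forall v, linear (G^~ v)) -> (forall u, linear (G u)) ->
  tsum (tsum t F) G = \tsum_(u ⊗ v <- t) tsum (F u v) G.
Proof. by move=> Gl Gr; rewrite (linear_tsum (g := tsum^~ G)) //; lin. Qed.

Section Mul.
Context (R : B ⊗ A -> A ⊗ B) (Q : A ⊗ B -> A ⊗ B) (hRQ : LR_twisting R Q).
Let hR := LR_twist hRQ.
Let Rlin := twist_linear hR.
Let Qlin := LR_linear hRQ.

Lemma LR_mul_linl y : linear (LR_mul R Q ^~ y).
Proof. by rewrite /LR_mul; lin. Qed.

Lemma LR_mul_linr x : linear (LR_mul R Q x).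
Proof. by rewrite /LR_mul; lin. Qed.

Lemma LR_mul_tens a b a' b' : LR_mul R Q (a ⊗ b) (a' ⊗ b') =
   \tsum_(a1 ⊗ b1' <- Q (a ⊗ b')) \tsum_(a1' ⊗ b1 <- R (b ⊗ a'))
      ((a1 * a1') ⊗ (b1 * b1')).
Proof. by rewrite /LR_mul !tsum_tens //; lin. Qed.

Context {W : lmodType k}.

Lemma twist_Ml_tsum (G : A -> B -> W) a a' b :
  (forall v, linear (G^~ v)) -> (forall u, linear (G u)) ->
  tsum (R (b ⊗ (a * a'))) G =
    \tsum_(a1 ⊗ b1 <- R (b ⊗ a)) \tsum_(a2 ⊗ b2 <- R (b1 ⊗ a')) G (a1 * a2) b2.
Proof.
move=> Gl Gr; rewrite (twist_Ml hR) tsum_tsum //; apply: eq_tsum => a1 b1.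
by rewrite tsum_tsum //; apply: eq_tsum => a2 b2; rewrite tsum_tens.
Qed.

Lemma twist_Mr_tsum (G : A -> B -> W) a b b' :
  (forall v, linear (G^~ v)) -> (forall u, linear (G u)) ->
  tsum (R ((b * b') ⊗ a)) G =
    \tsum_(a1 ⊗ b1 <- R (b' ⊗ a)) \tsum_(a2 ⊗ b2 <- R (b ⊗ a1)) G a2 (b2 * b1).
Proof.
move=> Gl Gr; rewrite (twist_Mr hR) tsum_tsum //; apply: eq_tsum => a1 b1.
by rewrite tsum_tsum //; apply: eq_tsum => a2 b2; rewrite tsum_tens.
Qed.

Lemma LR_Ml_tsum (G : A -> B -> W) a a' b :
  (forall v, linear (G^~ v)) -> (forall u, linear (G u)) ->
  tsum (Q ((a * a') ⊗ b)) G =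
    \tsum_(a1 ⊗ b1 <- Q (a' ⊗ b)) \tsum_(a2 ⊗ b2 <- Q (a ⊗ b1)) G (a2 * a1) b2.
Proof.
move=> Gl Gr; rewrite (LR_Ml hRQ) tsum_tsum //; apply: eq_tsum => a1 b1.
by rewrite tsum_tsum //; apply: eq_tsum => a2 b2; rewrite tsum_tens.
Qed.

Lemma LR_Mr_tsum (G : A -> B -> W) a b b' :
  (forall v, linear (G^~ v)) -> (forall u, linear (G u)) ->
  tsum (Q (a ⊗ (b * b'))) G =
    \tsum_(a1 ⊗ b1 <- Q (a ⊗ b)) \tsum_(a2 ⊗ b2 <- Q (a1 ⊗ b')) G a2 (b1 * b2).
Proof.
move=> Gl Gr; rewrite (LR_Mr hRQ) tsum_tsum //; apply: eq_tsum => a1 b1.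
by rewrite tsum_tsum //; apply: eq_tsum => a2 b2; rewrite tsum_tens.
Qed.

Lemma tsum3 (X Y Z : lmodType k) (G : X -> Y -> Z -> W) x y z :
  (forall y z, linear (fun x => G x y z)) ->
  (forall x z, linear (fun y => G x y z)) ->
  (forall x y, linear (fun z => G x y z)) ->
  tsum (x ⊗ (y ⊗ z)) (fun x t => tsum t (G x)) = G x y z.
Proof.
move=> G1 G2 G3; rewrite tsum_tens; first by rewrite tsum_tens //; lin.
- by move=> t; lin.
- by move=> x0; apply: tsum_linear.
Qed.

Lemma LR_RQl_tsum (G : B -> A -> B -> W) a b b' :
  (forall y z, linear (fun x => G x y z)) ->
  (forall x z, linear (fun y => G x y z)) ->
  (forall x y, linear (fun z => G x y z)) ->
  \tsum_(a1 ⊗ b1 <- R (b ⊗ a)) \tsum_(a2 ⊗ b2 <- Q (a1 ⊗ b')) G b1 a2 b2 =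
  \tsum_(a1 ⊗ b1 <- Q (a ⊗ b')) \tsum_(a2 ⊗ b2 <- R (b ⊗ a1)) G b2 a2 b1.
Proof.
move=> G1 G2 G3.
have := congr1 (tsum^~ (fun x t => tsum t (G x))) (LR_RQl hRQ a b b').
have L1 v : linear (fun x => tsum v (G x)) by apply: lin_tsum.
have L2 x : linear (fun t => tsum t (G x)) by apply: tsum_linear.
rewrite !tsum_tsum //.
under eq_tsum => a1 b1.
  rewrite tsum_tsum //; under eq_tsum => a2 b2 do rewrite tsum3 //.
  over.
under [RHS]eq_tsum => a1 b1.
  rewrite tsum_tsum //; under eq_tsum => a2 b2 do rewrite tsum3 //.
  over.
by [].
Qed.

Lemma LR_RQr_tsum (G : A -> B -> A -> W) a a' b :
  (forall y z, linear (fun x => G x y z)) ->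
  (forall x z, linear (fun y => G x y z)) ->
  (forall x y, linear (fun z => G x y z)) ->
  \tsum_(a1 ⊗ b1 <- R (b ⊗ a)) \tsum_(a2 ⊗ b2 <- Q (a' ⊗ b1)) G a1 b2 a2 =
  \tsum_(a1 ⊗ b1 <- Q (a' ⊗ b)) \tsum_(a2 ⊗ b2 <- R (b1 ⊗ a)) G a2 b2 a1.
Proof.
move=> G1 G2 G3.
have := congr1 (tsum^~ (fun x t => tsum t (G x))) (LR_RQr hRQ a a' b).
have L1 v : linear (fun x => tsum v (G x)) by apply: lin_tsum.
have L2 x : linear (fun t => tsum t (G x)) by apply: tsum_linear.
rewrite !tsum_tsum //.
under eq_tsum => a1 b1.
  rewrite tsum_tsum //; under eq_tsum => a2 b2 do rewrite tsum3 //.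
  over.
under [RHS]eq_tsum => a1 b1.
  rewrite tsum_tsum //; under eq_tsum => a2 b2 do rewrite tsum3 //.
  over.
by [].
Qed.
End Mul.

Section Algebra.
Context (R : B ⊗ A -> A ⊗ B) (Q : A ⊗ B -> A ⊗ B) (hRQ : LR_twisting R Q).
Let hR := LR_twist hRQ.
Let Rlin := twist_linear hR.
Let Qlin := LR_linear hRQ.
Let mul := LR_mul R Q.

Fact LR_mulA_tens a b a' b' a'' b'' :
  mul (mul (a ⊗ b) (a' ⊗ b')) (a'' ⊗ b'') =
  mul (a ⊗ b) (mul (a' ⊗ b') (a'' ⊗ b'')).
Proof.
rewrite /mul (LR_mul_tens hRQ a) (LR_mul_tens hRQ a').
rewrite (linear_tsum _ _ (LR_mul_linl hRQ _)) (linear_tsum _ _ (LR_mul_linr hRQ _)).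
transitivity (
  \tsum_(a1 ⊗ b1' <- Q (a ⊗ b')) \tsum_(a1' ⊗ b1'' <- Q (a' ⊗ b''))
  \tsum_(a2' ⊗ b1 <- R (b ⊗ a1')) \tsum_(a2 ⊗ b2'' <- Q (a1 ⊗ b1''))
  \tsum_(a1'' ⊗ b2' <- R (b1' ⊗ a'')) \tsum_(a2'' ⊗ b2 <- R (b1 ⊗ a1''))
    ((a2 * a2' * a2'') ⊗ (b2 * b2' * b2''))).
- apply: eq_tsum => a1 b1'.
  rewrite (linear_tsum _ _ (LR_mul_linl hRQ _)).
  rewrite -(LR_RQl_tsum hRQ (G := fun b1 a2' b1'' =>
    \tsum_(a2 ⊗ b2'' <- Q (a1 ⊗ b1''))
    \tsum_(a1'' ⊗ b2' <- R (b1' ⊗ a'')) \tsum_(a2'' ⊗ b2 <- R (b1 ⊗ a1''))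
    ((a2 * a2' * a2'') ⊗ (b2 * b2' * b2'')))); try by lin.
  apply: eq_tsum => a1' b1.
  rewrite (LR_mul_tens hRQ) (LR_Ml_tsum hRQ); try by lin.
  apply: eq_tsum => a2' b1''; apply: eq_tsum => a2 b2''.
  by rewrite (twist_Mr_tsum hRQ); try by lin.
rewrite tsum_exchange; apply: eq_tsum => a1' b1''.
rewrite (linear_tsum _ _ (LR_mul_linr hRQ _)).
transitivity (
  \tsum_(a1'' ⊗ b1' <- R (b' ⊗ a'')) \tsum_(a1 ⊗ b2' <- Q (a ⊗ b1'))
  \tsum_(a2 ⊗ b2'' <- Q (a1 ⊗ b1'')) \tsum_(a2' ⊗ b1 <- R (b ⊗ a1'))
  \tsum_(a2'' ⊗ b2 <- R (b1 ⊗ a1''))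
    ((a2 * (a2' * a2'')) ⊗ (b2 * (b2' * b2'')))).
  rewrite (LR_RQr_tsum hRQ (G := fun a1'' b2' a1 =>
    \tsum_(a2 ⊗ b2'' <- Q (a1 ⊗ b1'')) \tsum_(a2' ⊗ b1 <- R (b ⊗ a1'))
    \tsum_(a2'' ⊗ b2 <- R (b1 ⊗ a1''))
    ((a2 * (a2' * a2'')) ⊗ (b2 * (b2' * b2''))))); try by lin.
  apply: eq_tsum => a1 b1'.
  rewrite [LHS]tsum_exchange [RHS]tsum_exchange; apply: eq_tsum => a2 b2''.
  rewrite [LHS]tsum_exchange; apply: eq_tsum => a1'' b2'.
  apply: eq_tsum => a2' b1; apply: eq_tsum => a2'' b2.
  by rewrite !mulrA.
apply: eq_tsum => a1'' b1'.
rewrite (LR_mul_tens hRQ) (LR_Mr_tsum hRQ); try by lin.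
apply: eq_tsum => a1 b2'; apply: eq_tsum => a2 b2''.
by rewrite (twist_Ml_tsum hRQ); try by lin.
Qed.

Fact LR_mulA : associative mul.
Proof.
have ml y : linear (mul^~ y) := LR_mul_linl hRQ y.
have mr y : linear (mul y) := LR_mul_linr hRQ y.
move=> x y z; move: x.
apply: tensor_ext => [||a b].
- exact: ml.
- exact: lin_comp (ml z) (ml y).
move: y; apply: tensor_ext => [||a' b'].
- exact: lin_comp (mr _) (ml z).
- exact: lin_comp (ml z) (mr _).
move: z; apply: tensor_ext => [||a'' b''].
- exact: lin_comp (mr _) (mr _).
- exact: mr.
by rewrite LR_mulA_tens.
Qed.

Fact LR_mul1 : left_id (1 ⊗ 1 : A ⊗ B) mul.
Proof.
apply: tensor_ext => [||a b]; [exact: LR_mul_linr|exact: lin_id|].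
rewrite /mul (LR_mul_tens hRQ) (LR_1l hRQ) (twist_1l hR).
by rewrite !tsum_tens ?mul1r //; lin.
Qed.

Fact LR_mulr1 : right_id (1 ⊗ 1 : A ⊗ B) mul.
Proof.
apply: tensor_ext => [||a b]; [exact: LR_mul_linl|exact: lin_id|].
rewrite /mul (LR_mul_tens hRQ) (LR_1r hRQ) (twist_1r hR).
by rewrite !tsum_tens ?mulr1 //; lin.
Qed.

Fact LR_mulDl : left_distributive mul +%R.
Proof. by move=> x y z; have := LR_mul_linl hRQ z 1 x y; rewrite !scale1r. Qed.

Fact LR_mulDr : right_distributive mul +%R.
Proof. by move=> x y z; have := LR_mul_linr hRQ x 1 y z; rewrite !scale1r. Qed.

Fact LR_mulZl c x y : mul (c *: x) y = c *: mul x y.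
Proof.
have m0 : mul 0 y = 0.
  by apply: (addrI (mul 0 y)); rewrite -LR_mulDl !addr0.
by have := LR_mul_linl hRQ y c x 0; rewrite -/mul m0 !addr0.
Qed.

Fact LR_mulZr c x y : mul x (c *: y) = c *: mul x y.
Proof.
have m0 : mul x 0 = 0.
  by apply: (addrI (mul x 0)); rewrite -LR_mulDr !addr0.
by have := LR_mul_linr hRQ x c y 0; rewrite -/mul m0 !addr0.
Qed.
End Algebra.

(* A _Q⊗_R B *)
Definition LR_tensor R Q of LR_twisting R Q : Type := A ⊗ B.

Section LRTensor.
Context R Q (hRQ : LR_twisting R Q).
HB.instance Definition _ := GRing.Lmodule.copy (LR_tensor hRQ) (A ⊗ B)%type.
HB.instance Definition _ := Lmodule_isUAlgebra.Build k (LR_tensor hRQ)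
  (LR_mulA hRQ) (LR_mul1 hRQ) (LR_mulr1 hRQ) (LR_mulDl hRQ) (LR_mulDr hRQ)
  (LR_mulZl hRQ) (LR_mulZr hRQ).
End LRTensor.

Lemma LR_mul_id R : twisting_map R -> LR_mul R id =2 twist_mul R.
Proof.
move=> hR; have hRl := twist_linear hR => x y; apply: eq_tsum => a b.
by apply: eq_tsum => a' b'; rewrite tsum_tens //; lin.
Qed.

(* A ⊗_R B *)
Definition twisted_tensor R of twisting_map R : Type := A ⊗ B.

Section TwistedTensor.
Context R (hR : twisting_map R).
Let h := id_LR_twisting hR.
Let mulE := LR_mul_id hR.

Fact twist_mulA : associative (twist_mul R).
Proof. by move=> x y z; rewrite -!mulE (LR_mulA h). Qed.
Fact twist_mul1 : left_id (1 ⊗ 1 : A ⊗ B) (twist_mul R).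
Proof. by move=> x; rewrite -mulE (LR_mul1 h). Qed.
Fact twist_mulr1 : right_id (1 ⊗ 1 : A ⊗ B) (twist_mul R).
Proof. by move=> x; rewrite -mulE (LR_mulr1 h). Qed.
Fact twist_mulDl : left_distributive (twist_mul R) +%R.
Proof. by move=> x y z; rewrite -!mulE (LR_mulDl h). Qed.
Fact twist_mulDr : right_distributive (twist_mul R) +%R.
Proof. by move=> x y z; rewrite -!mulE (LR_mulDr h). Qed.
Fact twist_mulZl c x y : twist_mul R (c *: x) y = c *: twist_mul R x y.
Proof. by rewrite -!mulE (LR_mulZl h). Qed.
Fact twist_mulZr c x y : twist_mul R x (c *: y) = c *: twist_mul R x y.
Proof. by rewrite -!mulE (LR_mulZr h). Qed.

HB.instance Definition _ := GRing.Lmodule.copy (twisted_tensor hR) (A ⊗ B)%type.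
HB.instance Definition _ := Lmodule_isUAlgebra.Build k (twisted_tensor hR)
  twist_mulA twist_mul1 twist_mulr1 twist_mulDl twist_mulDr
  twist_mulZl twist_mulZr.
End TwistedTensor.
End Twisting.

Definition ualg_iso (k : fieldType) (E F : ualgType k) (f : E -> F) : Prop :=
  [/\ linear f, GRing.monoid_morphism f & bijective f].

(* Main.v *)
Require Import Defs.
From mathcomp Require Import all_boot all_algebra.

Set Implicit Arguments.
Unset Strict Implicit.
Unset Printing Implicit Defensive.

Import GRing.Theory.
Local Open Scope ring_scope.

(** As [Q \o P = R], applying [Q] to an identity for [P] turns it into one for
    [R]: the multiplicativity of [Q] splits [Q] over products, each [P] is
    absorbed by a [Q] to give an [R], and the commutation relations between [R]
    and [Q] put the remaining factors in the right order. *)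

Lemma can_linear (k : fieldType) (U V : lmodType k) (f : U -> V) (g : V -> U) :
  linear f -> cancel f g -> cancel g f -> linear g.
Proof. by move=> fl fK gK c x y; apply: (can_inj fK); rewrite fl !gK. Qed.

(** The two sides use the decompositions chosen for [t] and for [f t], which are unrelated;
    bilinearity of [G] makes the sums independent of these choices. *)
Lemma tsum_comp (k : fieldType) (U V U' V' W : lmodType k)
    (f : U ⊗ V -> U' ⊗ V') (t : U ⊗ V) (G : U' -> V' -> W) :
  linear f -> (forall v, linear (G^~ v)) -> (forall u, linear (G u)) ->
  \tsum_(u ⊗ v <- t) tsum (f (u ⊗ v)) G = tsum (f t) G.
Proof.
by move=> fl Gl Gr; rewrite -{2}(tsum_id t) (linear_tsum _ _ fl) tsum_tsum.
Qed.

Section BijectiveLRTwisting.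
Context {k : fieldType} {A B : ualgType k}.
Context (R : B ⊗ A -> A ⊗ B) (Q Qinv : A ⊗ B -> A ⊗ B).
Context (hRQ : LR_twisting R Q) (QK : cancel Q Qinv) (QinvK : cancel Qinv Q).
Let hR := LR_twist hRQ.
Let Rlin := twist_linear hR.
Let Qlin := LR_linear hRQ.
Let Qinvlin : linear Qinv := can_linear Qlin QK QinvK.
Local Notation P := (Qinv \o R).
Let Plin : linear P := lin_comp Qinvlin Rlin.

(** The Sweedler form of [Q \o P = R]. Read from right to left, it trades an [R] for [P] followed by
    [Q]. *)
Let tsum_QP (W : lmodType k) (G : A -> B -> W) t :
  (forall v, linear (G^~ v)) -> (forall u, linear (G u)) ->
  \tsum_(a ⊗ b <- P t) tsum (Q (a ⊗ b)) G = tsum (R t) G.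
Proof. by move=> Gl Gr; rewrite tsum_comp //= QinvK. Qed.

Lemma LR_twisting_inv_comp : twisting_map P.
Proof.
split=> [|a|b|a a' b|a b b'] //.
- by apply: (can_inj QK); rewrite QinvK (twist_1l hR) (LR_1r hRQ).
- by apply: (can_inj QK); rewrite QinvK (twist_1r hR) (LR_1l hRQ).
- apply: (can_inj QK); rewrite QinvK (linear_tsum _ _ Qlin).
  (* The rule for [R] on [a * a'], with only its first [R] traded for [Q] after [P]. *)
  transitivity (\tsum_(a1 ⊗ b1 <- P (b ⊗ a)) \tsum_(a3 ⊗ b3 <- Q (a1 ⊗ b1))
      \tsum_(a2 ⊗ b2 <- R (b3 ⊗ a')) ((a3 * a2) ⊗ b2)).
    by rewrite tsum_QP ?(twist_Ml hR) //; lin.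
  apply: eq_tsum => a1 b1; rewrite (linear_tsum _ _ Qlin).
  (* Now [R] acts on [b1 ⊗ a'] before [Q] does. Trading it too leaves two nested copies of [Q],
     which are [Q] of the product [a1 * a2]. *)
  rewrite -(LR_RQr_tsum hRQ (G := fun a2 b2 a3 => (a3 * a2) ⊗ b2)); try by lin.
  rewrite -tsum_QP; try by lin.
  by apply: eq_tsum => a2 b2; rewrite (LR_Ml hRQ).
- apply: (can_inj QK); rewrite QinvK (linear_tsum _ _ Qlin).
  transitivity (\tsum_(a1 ⊗ b1 <- P (b' ⊗ a)) \tsum_(a3 ⊗ b3 <- Q (a1 ⊗ b1))
      \tsum_(a2 ⊗ b2 <- R (b ⊗ a3)) (a2 ⊗ (b2 * b3))).
    by rewrite tsum_QP ?(twist_Mr hR) //; lin.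
  apply: eq_tsum => a1 b1; rewrite (linear_tsum _ _ Qlin).
  (* The mirror image: the copies of [Q] recombine on the product [b2 * b1] in [B]. *)
  rewrite -(LR_RQl_tsum hRQ (G := fun b2 a2 b3 => a2 ⊗ (b2 * b3))); try by lin.
  rewrite -tsum_QP; try by lin.
  by apply: eq_tsum => a2 b2; rewrite (LR_Mr hRQ).
Qed.

Lemma LR_twisting_morph_tens a b a' b' :
  Q (twist_mul P (a ⊗ b) (a' ⊗ b')) = LR_mul R Q (Q (a ⊗ b)) (Q (a' ⊗ b')).
Proof.
rewrite /twist_mul (tsum_tens a b); try by lin.
rewrite tsum_tens; try by lin.
rewrite (linear_tsum _ _ Qlin).
(* Splitting [Q] over both products gives four copies of [Q]; the one on the output of [P] has
   become [R], and three remain. *)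
transitivity (\tsum_(c ⊗ d <- R (b ⊗ a')) \tsum_(e ⊗ f <- Q (c ⊗ b'))
    \tsum_(g ⊗ h <- Q (a ⊗ d)) \tsum_(i ⊗ j <- Q (g ⊗ f))
      ((i * e) ⊗ (h * j))).
  rewrite -tsum_QP; try by lin.
  apply: eq_tsum => a1 b1; rewrite (LR_Ml hRQ) (LR_Mr_tsum hRQ); try by lin.
  apply: eq_tsum => c d; apply: eq_tsum => e f.
  by rewrite (LR_Mr_tsum hRQ) //; lin.
(* Moved ahead of [R], the [Q] involving [b'] produces the factor [Q (a' ⊗ b')]. *)
rewrite (LR_RQl_tsum hRQ (G := fun d e f => \tsum_(g ⊗ h <- Q (a ⊗ d))
  \tsum_(i ⊗ j <- Q (g ⊗ f)) ((i * e) ⊗ (h * j)))); try by lin.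
rewrite [RHS]tsum_exchange; apply: eq_tsum => c f.
(* Likewise the [Q] involving [a] produces [Q (a ⊗ b)]; the last [Q] and the [R] are those of
   [LR_mul]. *)
rewrite (LR_RQr_tsum hRQ (G := fun e h g =>
  \tsum_(i ⊗ j <- Q (g ⊗ f)) ((i * e) ⊗ (h * j)))); try by lin.
by apply: eq_tsum => g h; rewrite tsum_exchange.
Qed.

Lemma LR_twisting_morph x y :
  Q (twist_mul P x y) = LR_mul R Q (Q x) (Q y).
Proof.
have ml z : linear (LR_mul R Q ^~ z) := LR_mul_linl hRQ z.
have mr z : linear (LR_mul R Q z) := LR_mul_linr hRQ z.
move: x; apply: tensor_ext => [||a b].
- by rewrite /twist_mul; lin.
- exact: lin_comp (ml _) Qlin.
move: y; apply: tensor_ext => [||a' b'].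
- by rewrite /twist_mul; lin.
- exact: lin_comp (mr _) Qlin.
exact: LR_twisting_morph_tens.
Qed.

End BijectiveLRTwisting.

Theorem proposition2p9 (k : fieldType) (A B : ualgType k)
    (R : B ⊗ A -> A ⊗ B) (Q Qinv : A ⊗ B -> A ⊗ B)
    (hRQ : LR_twisting R Q) (QK : cancel Q Qinv) (QinvK : cancel Qinv Q) :
  exists hP : twisting_map (Qinv \o R),
    @ualg_iso k (twisted_tensor hP) (LR_tensor hRQ) Q.
Proof.
exists (LR_twisting_inv_comp hRQ QK QinvK); split.
- exact: LR_linear hRQ.
(* Both algebras have the unit [1 ⊗ 1], which [Q] fixes. *)
- split; first exact: LR_1r hRQ 1.
  exact: LR_twisting_morph hRQ QK QinvK.
- by exists Qinv.
Qed.
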